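(* The set $C_{K_6}$ of all $6$-satisfactory colorings of $K_6$ has cardinality $\mathfrak c=|\mathbb R|$.
   Context: $K_6$ is the set of positive integers whose prime factors all lie in $\{2,3,5\}$. A $6$-satisfactory coloring of $K_6$ is a map $c:K_6\to\{1,\dots,6\}$ with $c(i)=i$ for $1\le i\le 6$ and such that for every $a\in K_6$ the colors $c(a),c(2a),\dots,c(6a)$ are all different. *)

(* Defs.v *)
From mathcomp Require Import all_boot all_order all_algebra.
From mathcomp Require Import boolp classical_sets functions cardinality reals.

Set Implicit Arguments.
Unset Strict Implicit.
Unset Printing Implicit Defensive.

Definition pi235 : nat_pred := [pred p in [:: 2; 3; 5]].

Definition K6 := {n : nat | pi235.-nat n}.

Definition color6 := {i : nat | 0 < i <= 6}.

Lemma color6_pnat (i : color6) : pi235.-nat (val i).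
Proof. by case: i => [[|[|[|[|[|[|[|]]]]]]]]. Qed.

Definition K6_of_color (i : color6) : K6 :=
  exist (fun n => pi235.-nat n) (val i) (color6_pnat i).

Lemma K6_mul_pnat (a b : K6) : pi235.-nat (val a * val b).
Proof. by rewrite pnatM (valP a) (valP b). Qed.

Definition K6_mul (a b : K6) : K6 :=
  exist (fun n => pi235.-nat n) (val a * val b) (K6_mul_pnat a b).

Definition satisfactory6 (c : K6 -> color6) : Prop :=
  (forall i : color6, c (K6_of_color i) = i) /\
  (forall a : K6, injective (fun i : color6 => c (K6_mul (K6_of_color i) a))).

Definition C_K6 : set (K6 -> color6) := [set c | satisfactory6 c]%classic.

(* Main.v *)
Require Import Defs.
From mathcomp Require Import all_boot all_order all_algebra.
From mathcomp Require Import boolp classical_sets functions cardinality reals.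
From mathcomp Require Import lra.

(** Why the cardinality is the continuum.

    Upper bound: [K6] is countable and there are six colors, so a coloring is
    coded by its graph, a set of natural numbers; and the sets of natural
    numbers are equinumerous with the reals by [card_powerset_nat].

    Lower bound: write an element of [K6] as 2^x 3^y 5^z.  Assign to it the row
    y + z and the column x + 2z.  Both are additive, and the six factors
    1, 2, 4 sit at columns 0, 1, 2 of row 0 while 3, 6, 5 sit at columns
    0, 1, 2 of row 1.  Multiplying a by 1, ..., 6 thus meets three consecutive
    columns of the row of a and three consecutive columns of the next row.
    Hence any coloring that runs periodically through 1, 2, 4 along each even
    row and through 3, 6, 5 along each odd row gives these six products six
    different colors, and the phase of the period may be chosen separately in
    each row ([shear_coloring_satisfactory]).  The condition that i has color i
    fixes the phases of rows 0 and 1 only; a set of natural numbers prescribes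
    the phases of the others, and the color of 3^n reveals the phase of row n
    ([shear_of_set_inj]). *)

Import Order.TTheory GRing.Theory Num.Theory.

Local Open Scope classical_set_scope.
Local Open Scope card_scope.

Lemma card_le_inj {T U} {A : set T} {B : set U} {f : T -> U} :
  (forall x, A x -> B (f x)) -> injective f -> A #<= B.
Proof.
move=> fAB f_inj; apply: (@card_le_trans _ _ _ (f @` A)).
  have : f @` A #= A by apply: inj_card_eq => x y _ _ /f_inj.
  by rewrite card_eq_le => /andP[].
by apply: subset_card_le => _ [x Ax <-]; exact: fAB.
Qed.

Section TernarySum.
Variable R : realType.
Local Open Scope ring_scope.

Definition ternary_partial (A : set nat) (n : nat) : R :=
  \sum_(i < n) (`[< A i >]%:R / 3 ^+ i).

(** Base 3 with digits 0 and 1 makes the expansion unique: at the first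
    difference, the missing 3^-n exceeds the sum 3^-n / 2 of all later terms. *)
Definition ternary_sum (A : set nat) : R := sup (range (ternary_partial A)).

Lemma ternary_partialS A n :
  ternary_partial A n.+1 = ternary_partial A n + `[< A n >]%:R / 3 ^+ n.
Proof. by rewrite /ternary_partial big_ord_recr. Qed.

Lemma ternary_partial_le A m n : (m <= n)%N ->
  ternary_partial A m <= ternary_partial A n.
Proof.
move=> /subnK <-; elim: (n - m)%N => [|k IH] //=.
by rewrite addSn ternary_partialS (le_trans IH) // lerDl divr_ge0 // exprn_ge0.
Qed.

(** The quantity s_m + (3/2) 3^-m, where (3/2) 3^-m is the sum of the geometric
    series from index m on, decreases with m because each new digit is at
    most 1. *)
Lemma ternary_partial_tail A m n :
  ternary_partial A n <= ternary_partial A m + 3 / 2 / 3 ^+ m.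
Proof.
have tail_ge0 k : (0 : R) <= 3 / 2 / 3 ^+ k.
  by rewrite !divr_ge0 // exprn_ge0.
have [le_nm | /ltnW /subnK <-] := leqP n m.
  by rewrite -[leLHS]addr0 lerD // ternary_partial_le.
suff : ternary_partial A (n - m + m) + 3 / 2 / 3 ^+ (n - m + m)
    <= ternary_partial A m + 3 / 2 / 3 ^+ m.
  by apply: le_trans; rewrite lerDl.
elim: (n - m)%N => [|k IH] //=; apply: le_trans IH.
rewrite addSn ternary_partialS exprS invfM.
have : (0 : R) <= (3 ^+ (k + m))^-1 by rewrite invr_ge0 exprn_ge0.
by case: `[< _ >]; rewrite /=; lra.
Qed.

Lemma ternary_sum_ge A n : ternary_partial A n <= ternary_sum A.
Proof.
apply: ub_le_sup; last by exists n.
exists (ternary_partial A 0 + 3 / 2 / 3 ^+ 0) => _ [m _ <-].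
exact: ternary_partial_tail.
Qed.

Lemma ternary_sum_le A m :
  ternary_sum A <= ternary_partial A m + 3 / 2 / 3 ^+ m.
Proof.
apply: ge_sup; first by exists (ternary_partial A 0); exists 0%N.
by move=> _ [n _ <-]; apply: ternary_partial_tail.
Qed.

Lemma ternary_sum_lt A B n : (forall i, (i < n)%N -> A i = B i) ->
  ~ A n -> B n -> ternary_sum A < ternary_sum B.
Proof.
move=> eqAB nAn Bn.
have eqn : ternary_partial A n = ternary_partial B n.
  by apply: eq_bigr => i _; rewrite eqAB.
have := ternary_sum_le A n.+1; have := ternary_sum_ge B n.+1.
rewrite !ternary_partialS eqn (asboolT Bn) (asboolF nAn) exprS invfM /=.
have : (0 : R) < (3 ^+ n)^-1 by rewrite invr_gt0 exprn_gt0.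
lra.
Qed.

Lemma ternary_sum_inj : injective ternary_sum.
Proof.
move=> A B eqAB; apply/funext; elim/ltn_ind => n IH.
have [An|nAn] := pselect (A n); have [Bn|nBn] := pselect (B n).
- by apply/propext.
- have := @ternary_sum_lt B A n (fun i lt_in => esym (IH i lt_in)) nBn An.
  by rewrite eqAB ltxx.
- have := @ternary_sum_lt A B n IH nAn Bn.
  by rewrite eqAB ltxx.
- by apply/propext.
Qed.

Definition rational_cut (x : R) : set nat :=
  [set n | exists2 q : rat, n = pickle q & ratr q < x].

(** Two different reals are separated by a rational. *)
Lemma rational_cut_inj : injective rational_cut.
Proof.
suff cut_le x y : rational_cut x = rational_cut y -> x <= y.
  by move=> x y eqxy; apply: le_anti; rewrite !cut_le.
move=> eqxy; rewrite leNgt; apply/negP => /rat_in_itvoo[q].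
rewrite in_itv /= => /andP[ltyq ltqx].
have : rational_cut x (pickle q) by exists q.
rewrite eqxy => -[q' /(pcan_inj pickleK) <-].
by rewrite ltNge ltW.
Qed.

Lemma card_powerset_nat : [set: set nat] #= [set: R].
Proof.
rewrite card_eqPle; split.
  exact: (card_le_inj _ ternary_sum_inj).
exact: (card_le_inj _ rational_cut_inj).
Qed.

End TernarySum.

Definition coloring_graph (c : K6 -> color6) : set nat :=
  [set n | exists a, n = pickle (val a, val (c a))].

Lemma coloring_graph_inj : injective coloring_graph.
Proof.
move=> c d eqcd; apply/funext => a.
have : coloring_graph c (pickle (val a, val (c a))) by exists a.
rewrite eqcd => -[b /(pcan_inj pickleK) [/val_inj <- /val_inj]].
by [].
Qed.

(** Coordinates on [K6]: in the plane of (row, column), multiplication by 2 is a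
    step along the row, and 3, 6, 5 lead to three consecutive places of the
    next row. *)
Definition row_index n := logn 3 n + logn 5 n.
Definition col_index n := logn 2 n + 2 * logn 5 n.

Lemma row_indexM m n : 0 < m -> 0 < n ->
  row_index (m * n) = row_index m + row_index n.
Proof. by move=> m0 n0; rewrite /row_index !lognM // addnACA. Qed.

Lemma col_indexM m n : 0 < m -> 0 < n ->
  col_index (m * n) = col_index m + col_index n.
Proof. by move=> m0 n0; rewrite /col_index !lognM // mulnDr addnACA. Qed.

(** The residues modulo 2 and 3 of the two coordinates identify a color;
    [palette] inverts this map. *)
Definition palette (p r : nat) : nat :=
  nth 1 (if odd p then [:: 3; 6; 5] else [:: 1; 2; 4]) (r %% 3).

Lemma palette_color p r : 0 < palette p r <= 6.
Proof.
by rewrite /palette; case: (odd p); case: (r %% 3) => [|[|[|[]]]].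
Qed.

Lemma row_index_palette p r : row_index (palette p r) = odd p.
Proof.
rewrite /palette; have := ltn_pmod r (isT : 0 < 3).
by case: (odd p); case: (r %% 3) => [|[|[|]]].
Qed.

Lemma col_index_palette p r : col_index (palette p r) = r %% 3.
Proof.
rewrite /palette; have := ltn_pmod r (isT : 0 < 3).
by case: (odd p); case: (r %% 3) => [|[|[|]]].
Qed.

Lemma palette_index (i : color6) :
  palette (row_index (val i)) (col_index (val i)) = val i.
Proof. by case: i => [[|[|[|[|[|[|[|]]]]]]]]. Qed.

(** The phase [t] of a row depends on the row alone; this is the freedom that
    yields uncountably many colorings. *)
Definition shear_coloring (t : nat -> nat) (a : K6) : color6 :=
  exist (fun i => 0 < i <= 6) _
    (palette_color (row_index (val a))
       (col_index (val a) + t (row_index (val a)))).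

Lemma color6_index_inj (i j : color6) :
  odd (row_index (val i)) = odd (row_index (val j)) ->
  col_index (val i) = col_index (val j) %[mod 3] -> i = j.
Proof.
move=> eq_row eq_col; apply: val_inj.
by rewrite -palette_index -[RHS]palette_index /palette eq_row eq_col.
Qed.

(** Equal colors of i * a and j * a lie in rows of equal parity.  Since i and j
    have row 0 or 1, the rows coincide, so both products see the same phase; it
    cancels, and the columns of i and j agree modulo 3. *)
Lemma shear_coloring_satisfactory t : t 0 = 0 -> t 1 = 0 ->
  satisfactory6 (shear_coloring t).
Proof.
move=> t0 t1; split=> [i | a i j /(congr1 val) /= eq_pal].
  apply: val_inj; rewrite /= -[RHS]palette_index.
  have -> : t (row_index (val i)) = 0.
    by case: i => [[|[|[|[|[|[|[|]]]]]]]] //= lti; rewrite ?t0 ?t1.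
  by rewrite addn0.
have gt0 (k : color6) : 0 < val k by case/andP: (valP k).
have a0 : 0 < val a by case/andP: (valP a).
have {}eq_pal :
    palette (row_index (val i) + row_index (val a))
      (col_index (val i) + col_index (val a)
       + t (row_index (val i) + row_index (val a))) =
    palette (row_index (val j) + row_index (val a))
      (col_index (val j) + col_index (val a)
       + t (row_index (val j) + row_index (val a))).
  by rewrite -!row_indexM // -!col_indexM.
have row_bit (k : color6) : row_index (val k) = odd (row_index (val k)).
  by rewrite -[in LHS](palette_index k) row_index_palette.
have eq_row : row_index (val i) = row_index (val j).
  have := congr1 row_index eq_pal; rewrite !row_index_palette.
  rewrite !(oddD (row_index _)) row_bit (row_bit j) !oddb.
  by case: (odd (row_index (val i))); case: (odd (row_index (val j)));
    case: (odd (row_index (val a))).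
apply: color6_index_inj; first by rewrite eq_row.
have := congr1 col_index eq_pal; rewrite !col_index_palette eq_row.
rewrite -!(addnA (col_index _) (col_index _)).
by move/eqP; rewrite eqn_modDr => /eqP.
Qed.

(** Rows 0 and 1 keep phase 0, as the colors of 1, ..., 6 require. *)
Definition shear_of_set (A : set nat) (n : nat) : nat :=
  if n is n'.+2 then `[< A n' >] : nat else 0.

Lemma pow3_K6 n : pi235.-nat (3 ^ n).
Proof. by rewrite pnatX. Qed.

(** The element 3^(n+2) has row n+2 and column 0, so the column of its color is
    the phase of that row. *)
Lemma shear_of_set_inj : injective (fun A => shear_coloring (shear_of_set A)).
Proof.
move=> A B eqAB; apply/funext => n.
pose a : K6 := exist (fun m => pi235.-nat m) _ (pow3_K6 n.+2).
have := congr1 (fun c => col_index (val (c a))) eqAB.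
rewrite /= !col_index_palette /row_index /col_index !lognX /=.
rewrite !muln0 !muln1 !addn0 !add0n /=.
by case: asboolP => An; case: asboolP => Bn // _; apply/propext.
Qed.

Theorem theorem5p6 (R : realType) : C_K6 #= [set: R].
Proof.
apply: card_eq_trans (card_powerset_nat R).
rewrite card_eqPle; split.
  exact: (card_le_inj _ coloring_graph_inj).
apply: (card_le_inj _ shear_of_set_inj) => A _.
exact: shear_coloring_satisfactory.
Qed.
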